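(* Consider the curved $3$-body problem in $\mathbb H^3$ with equal masses $m_1=m_2=m_3=:m>0$. Then every solution of the form $$w_1=0,\ x_1=0,\ y_1=\sinh\beta(t),\ z_1=\cosh\beta(t),$$ $$w_2=r(t)\cos\alpha(t),\ x_2=r(t)\sin\alpha(t),\ y_2=\rho(t)\sinh\beta(t),\ z_2=\rho(t)\cosh\beta(t),$$ $$w_3=-r(t)\cos\alpha(t),\ x_3=-r(t)\sin\alpha(t),\ y_3=\rho(t)\sinh\beta(t),\ z_3=\rho(t)\cosh\beta(t),$$ with $\alpha$ and $\beta$ nonconstant functions and $r^2-\rho^2=-1$, is a negative elliptic-hyperbolic Eulerian relative equilibrium, which rotates relative to the planes $wx$ and $yz$ but has no rotation with respect to the planes $wy,wz,xy$ and $xz$.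
   Context: Dots denote $d/dt$. $\mathbb H^3=\{(w,x,y,z): w^2+x^2+y^2-z^2=-1,\ z>0\}$ in Minkowski space $\mathbb R^{3,1}$, $\cdot$ is the Lorentz inner product of signature $(+,+,+,-)$, $\mathbf q_i=(w_i,x_i,y_i,z_i)$, $q_{ij}:=\mathbf q_i\cdot\mathbf q_j$, $\dot q_{ii}:=\dot{\mathbf q}_i\cdot\dot{\mathbf q}_i$. The curved $3$-body problem in $\mathbb H^3$ is the system $$\ddot{\mathbf q}_i=\sum_{j\ne i}\frac{m_j(\mathbf q_j+q_{ij}\mathbf q_i)}{(q_{ij}^2-1)^{3/2}}+\dot q_{ii}\mathbf q_i,\quad q_{ii}=-1,\quad i=1,2,3.$$ A negative elliptic-hyperbolic relative equilibrium is a solution of the form $w_i=r_i(t)\cos[\alpha(t)+a_i]$, $x_i=r_i(t)\sin[\alpha(t)+a_i]$, $y_i=\rho_i(t)\sinh[\beta(t)+b_i]$, $z_i=\rho_i(t)\cosh[\beta(t)+b_i]$, with $a_i,b_i$ constants, $\alpha,\beta$ nonconstant, $z_i\ge1$, $r_i^2-\rho_i^2=-1$, for which all $q_{ij}$, $i\ne j$, are constant. Eulerian means that the bodies lie at every instant on the same (moving) geodesic. For coordinates $u,v$ among $w,x,y,z$, let $c_{uv}=\sum_im_i(u_i\dot v_i-\dot u_iv_i)$ (a constant of motion); the system rotates relative to the plane $uv$ if $c_{uv}\ne0$ and has no rotation with respect to it if $c_{uv}=0$. *)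

(* Defs.v *)
From Stdlib Require Import Reals Lra.
From Coquelicot Require Import Coquelicot.
Open Scope R_scope.

Inductive coord : Set := Cw | Cx | Cy | Cz.

Definition vec : Type := coord -> R.

Definition vec4 (w x y z : R) : vec :=
  fun k => match k with Cw => w | Cx => x | Cy => y | Cz => z end.

(* Lorentz inner product of signature (+,+,+,-). *)
Definition lorentz (p q : vec) : R :=
  p Cw * q Cw + p Cx * q Cx + p Cy * q Cy - p Cz * q Cz.

Definition in_H3 (p : vec) : Prop := lorentz p p = -1 /\ 0 < p Cz.

Inductive body : Set := Body1 | Body2 | Body3.

Definition body_eq_dec (i j : body) : {i = j} + {i <> j}.
Proof. decide equality. Defined.

Definition sum3 (f : body -> R) : R := f Body1 + f Body2 + f Body3.

(* Open time interval with possibly infinite endpoints. *)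
Definition in_itv (T0 T1 : Rbar) (t : R) : Prop := Rbar_lt T0 t /\ Rbar_lt t T1.

(* Both conjuncts are needed: [Derive] is total, so [ex_derive (Derive f) t]
   alone does not make [f] differentiable. *)
Definition twice_diff_on (T0 T1 : Rbar) (f : R -> R) : Prop :=
  forall t, in_itv T0 T1 t -> ex_derive f t /\ ex_derive (Derive f) t.

Definition constant_on (T0 T1 : Rbar) (f : R -> R) : Prop :=
  exists c, forall t, in_itv T0 T1 t -> f t = c.

Definition nonconstant_on (T0 T1 : Rbar) (f : R -> R) : Prop :=
  exists s t, in_itv T0 T1 s /\ in_itv T0 T1 t /\ f s <> f t.

Definition vel (g : R -> vec) : R -> vec :=
  fun t k => Derive (fun s => g s k) t.

Definition acc (g : R -> vec) : R -> vec := vel (vel g).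

Definition motion : Type := body -> R -> vec.

Definition accel (m : body -> R) (q : motion) (i : body) (t : R) : vec :=
  fun k =>
    sum3 (fun j =>
      if body_eq_dec i j then 0
      else m j * (q j t k + lorentz (q i t) (q j t) * q i t k)
           / Rpower (lorentz (q i t) (q j t) ^ 2 - 1) (3 / 2))
    + lorentz (vel (q i) t) (vel (q i) t) * q i t k.

(* The strict inequality says that no collision occurs: it is the domain of
   the right-hand side, on which [Rpower] is the genuine real power. *)
Definition solution (m : body -> R) (T0 T1 : Rbar) (q : motion) : Prop :=
  (forall i k, twice_diff_on T0 T1 (fun t => q i t k)) /\
  forall t, in_itv T0 T1 t ->
    (forall i, in_H3 (q i t)) /\
    (forall i j, i <> j -> 0 < lorentz (q i t) (q j t) ^ 2 - 1) /\
    (forall i k, acc (q i) t k = accel m q i t k).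

Definition neg_elliptic_hyperbolic_RE
    (m : body -> R) (T0 T1 : Rbar) (q : motion) : Prop :=
  solution m T0 T1 q /\
  (exists (r rho : body -> R -> R) (alpha beta : R -> R) (a b : body -> R),
    (forall i, twice_diff_on T0 T1 (r i) /\ twice_diff_on T0 T1 (rho i)) /\
    twice_diff_on T0 T1 alpha /\ twice_diff_on T0 T1 beta /\
    nonconstant_on T0 T1 alpha /\ nonconstant_on T0 T1 beta /\
    forall i t, in_itv T0 T1 t ->
      (forall k, q i t k =
        vec4 (r i t * cos (alpha t + a i)) (r i t * sin (alpha t + a i))
             (rho i t * sinh (beta t + b i)) (rho i t * cosh (beta t + b i)) k) /\
      1 <= q i t Cz /\
      r i t ^ 2 - rho i t ^ 2 = -1) /\
  (forall i j, i <> j ->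
    constant_on T0 T1 (fun t => lorentz (q i t) (q j t))).

(* Unit-speed geodesic of H^3: the covariant acceleration
   [acc g - (vel g . vel g) g] vanishes. *)
Definition geodesic (g : R -> vec) : Prop :=
  (forall k s, ex_derive (fun u => g u k) s /\
               ex_derive (Derive (fun u => g u k)) s) /\
  forall s,
    in_H3 (g s) /\
    lorentz (vel g s) (vel g s) = 1 /\
    (forall k, acc g s k = lorentz (vel g s) (vel g s) * g s k).

(* The geodesic may depend on the instant [t]. *)
Definition Eulerian (T0 T1 : Rbar) (q : motion) : Prop :=
  forall t, in_itv T0 T1 t ->
    exists g, geodesic g /\
      forall i, exists s, forall k, q i t k = g s k.

Definition ang_mom (m : body -> R) (q : motion) (u v : coord) (t : R) : R :=
  sum3 (fun i => m i * (q i t u * vel (q i) t v - vel (q i) t u * q i t v)).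

Definition rotates (m : body -> R) (T0 T1 : Rbar) (q : motion) (u v : coord) : Prop :=
  exists c, c <> 0 /\ forall t, in_itv T0 T1 t -> ang_mom m q u v t = c.

Definition no_rotation (m : body -> R) (T0 T1 : Rbar) (q : motion) (u v : coord) : Prop :=
  forall t, in_itv T0 T1 t -> ang_mom m q u v t = 0.

(* Main.v *)
(** On every body the [(y,z)]-components, and likewise the [(w,x)]-components,
    of the three position vectors are parallel, so the force on each body has
    no torque in these two planes and each body conserves its own two areal
    velocities, [- rho_i^2 beta'] and [r_i^2 alpha'].  For the first body this
    says that [beta'] is constant, and it is nonzero because [beta] is not
    constant; for the second one it then says that [rho] is constant.  All the
    mutual products are polynomials in [rho], hence constant.  The remaining
    four angular momenta vanish by the symmetry exchanging bodies 2 and 3. *)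
Require Import Defs.
From Stdlib Require Import Reals Lra.
From Coquelicot Require Import Coquelicot.
Open Scope R_scope.

(** * Calculus on an open, possibly unbounded, time interval *)

Lemma locally_in_itv (T0 T1 : Rbar) (t : R) :
  in_itv T0 T1 t -> locally t (in_itv T0 T1).
Proof.
  intros [h0 h1]. apply filter_and.
  - exact (open_Rbar_gt T0 t h0).
  - exact (open_Rbar_lt T1 t h1).
Qed.

Lemma in_itv_between (T0 T1 : Rbar) (s t u : R) :
  in_itv T0 T1 s -> in_itv T0 T1 t -> s <= u <= t -> in_itv T0 T1 u.
Proof.
  intros [h0 _] [_ h1] [hsu hut]. split.
  - exact (Rbar_lt_le_trans T0 s u h0 hsu).
  - exact (Rbar_le_lt_trans u t T1 hut h1).
Qed.

(** The interval is open and a derivative depends only on the germ, so formulas for the coordinates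
    that hold only inside the interval can still be differentiated there. *)
Lemma Derive_ext_on (T0 T1 : Rbar) (f g : R -> R) (t : R) :
  in_itv T0 T1 t -> (forall s, in_itv T0 T1 s -> f s = g s) ->
  Derive f t = Derive g t.
Proof.
  intros ht h. apply Derive_ext_loc.
  exact (filter_imp _ _ h (locally_in_itv T0 T1 t ht)).
Qed.

Lemma derive_zero_eq (T0 T1 : Rbar) (f : R -> R) (s t : R) :
  (forall u, in_itv T0 T1 u -> is_derive f u 0) ->
  in_itv T0 T1 s -> in_itv T0 T1 t -> f s = f t.
Proof.
  intros hf hs ht.
  destruct (Rtotal_order s t) as [h | [-> | h]]; [| reflexivity | symmetry].
  all: apply (eq_is_derive f); [| exact h].
  all: intros u hu; apply hf; eauto using in_itv_between.
Qed.

(** Combined with a conserved areal velocity, this turns nonconstancy of an angle into a nonzero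
    angular speed at any chosen instant. *)
Lemma nonconstant_derive (T0 T1 : Rbar) (f : R -> R) :
  twice_diff_on T0 T1 f -> nonconstant_on T0 T1 f ->
  ~ (forall t, in_itv T0 T1 t -> Derive f t = 0).
Proof.
  intros hf (s & t & hs & ht & hst) h0. apply hst.
  apply (derive_zero_eq T0 T1); [| exact hs | exact ht].
  intros u hu. rewrite <- (h0 u hu). apply Derive_correct, hf, hu.
Qed.

(** * Areal velocities and their conservation *)

Definition area (g : R -> vec) (u v : coord) (t : R) : R :=
  g t u * vel g t v - vel g t u * g t v.

(** Each force term is a combination of [q j] and [q i], and the constraint term is a multiple of
    [q i]; in the [(u,v)] plane all of these are parallel to [q i], so the torque vanishes summand
    by summand. *)
Lemma parallel_accel (m : body -> R) (q : motion) (i : body) (u v : coord) (t : R) :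
  (forall j, q j t u * q i t v = q j t v * q i t u) ->
  q i t u * accel m q i t v = accel m q i t u * q i t v.
Proof.
  intros h. unfold accel, sum3.
  (* The denominator enters only through the scalar factor [/ D], so one identity with [D] arbitrary
     serves all three summands. *)
  assert (term : forall j D,
    q i t u * (if body_eq_dec i j then 0
      else m j * (q j t v + lorentz (q i t) (q j t) * q i t v) / D)
    = (if body_eq_dec i j then 0
      else m j * (q j t u + lorentz (q i t) (q j t) * q i t u) / D) * q i t v).
  { intros j D. destruct (body_eq_dec i j); [ring |]. unfold Rdiv.
    transitivity (m j * / D * (q j t v * q i t u
      + lorentz (q i t) (q j t) * q i t v * q i t u)); [ring |].
    rewrite <- h. ring. }
  rewrite 3!Rmult_plus_distr_l, 3!Rmult_plus_distr_r.
  repeat apply (f_equal2 Rplus); [apply term .. | ring].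
Qed.

(** In the derivative of [u v' - u' v] the products of first derivatives cancel; what is left,
    [u v'' - u'' v], is the torque, which is zero by [parallel_accel]. *)
Lemma area_constant (m : body -> R) (T0 T1 : Rbar) (q : motion) (i : body) (u v : coord) :
  solution m T0 T1 q ->
  (forall t, in_itv T0 T1 t -> forall j, q j t u * q i t v = q j t v * q i t u) ->
  forall s t, in_itv T0 T1 s -> in_itv T0 T1 t ->
    area (q i) u v s = area (q i) u v t.
Proof.
  intros [hd hs] hpar s t. apply derive_zero_eq. clear s t. intros t ht.
  destruct (hs t ht) as (_ & _ & heq).
  destruct (hd i u t ht) as [du ddu]. destruct (hd i v t ht) as [dv ddv].
  pose proof (parallel_accel m q i u v t (hpar t ht)) as hF.
  rewrite <- !heq in hF.
  unfold area, vel.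
  set (f := fun s => q i s u) in *. set (g := fun s => q i s v) in *.
  evar_last.
  - apply (is_derive_minus (fun s => f s * Derive g s) (fun s => Derive f s * g s)).
    + apply (is_derive_mult f (Derive g)); [now apply Derive_correct .. | apply Rmult_comm].
    + apply (is_derive_mult (Derive f) g); [now apply Derive_correct .. | apply Rmult_comm].
  - change (f t * Derive (Derive g) t = Derive (Derive f) t * g t) in hF.
    unfold minus, plus, opp, mult; cbn -[Derive]. lra.
Qed.

(** * Hyperbolic identities and angular momenta in polar form *)

Lemma is_derive_sinh (x : R) : is_derive sinh x (cosh x).
Proof. apply is_derive_Reals, derivable_pt_lim_sinh. Qed.

Lemma is_derive_cosh (x : R) : is_derive cosh x (sinh x).
Proof. apply is_derive_Reals, derivable_pt_lim_cosh. Qed.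

Lemma cosh2_sinh2 (x : R) : cosh x * cosh x - sinh x * sinh x = 1.
Proof.
  unfold cosh, sinh. pose proof (exp_plus x (- x)) as h.
  rewrite Rplus_opp_r, exp_0 in h. lra.
Qed.

Lemma cosh_ge_1 (x : R) : 1 <= cosh x.
Proof.
  pose proof (cosh2_sinh2 x).
  assert (0 < cosh x) by (unfold cosh; pose proof (exp_pos x); pose proof (exp_pos (- x)); lra).
  nra.
Qed.

Lemma is_derive_mult_comp (f g h : R -> R) (t l : R) :
  ex_derive f t -> ex_derive h t -> is_derive g (h t) l ->
  Derive (fun s => f s * g (h s)) t = Derive f t * g (h t) + f t * (Derive h t * l).
Proof.
  intros hf hh hg. apply is_derive_unique.
  apply (is_derive_mult f (fun s => g (h s)) t).
  - now apply Derive_correct.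
  - apply (is_derive_comp g h); [exact hg | now apply Derive_correct].
  - intros. apply Rmult_comm.
Qed.

Lemma area_circular (T0 T1 : Rbar) (g : R -> vec) (r a : R -> R) (u v : coord) (t : R) :
  twice_diff_on T0 T1 r -> twice_diff_on T0 T1 a ->
  (forall s, in_itv T0 T1 s -> g s u = r s * cos (a s) /\ g s v = r s * sin (a s)) ->
  in_itv T0 T1 t -> area g u v t = r t ^ 2 * Derive a t.
Proof.
  intros hr ha h ht. unfold area, vel.
  rewrite (Derive_ext_on T0 T1 (fun s => g s u) _ t ht (fun s hs => proj1 (h s hs))).
  rewrite (Derive_ext_on T0 T1 (fun s => g s v) _ t ht (fun s hs => proj2 (h s hs))).
  destruct (h t ht) as [-> ->].
  destruct (hr t ht) as [dr _]. destruct (ha t ht) as [da _].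
  rewrite (is_derive_mult_comp r cos a t _ dr da (is_derive_cos _)).
  rewrite (is_derive_mult_comp r sin a t _ dr da (is_derive_sin _)).
  pose proof (sin2_cos2 (a t)) as e. unfold Rsqr in e.
  transitivity (r t ^ 2 * Derive a t * (sin (a t) * sin (a t) + cos (a t) * cos (a t)));
    [ring | rewrite e; ring].
Qed.

(** The terms in [r'] cancel as in the circular case; the sign is negative because [sinh] is the
    first component, which leaves the factor [sinh^2 - cosh^2 = -1]. *)
Lemma area_hyperbolic (T0 T1 : Rbar) (g : R -> vec) (r a : R -> R) (u v : coord) (t : R) :
  twice_diff_on T0 T1 r -> twice_diff_on T0 T1 a ->
  (forall s, in_itv T0 T1 s -> g s u = r s * sinh (a s) /\ g s v = r s * cosh (a s)) ->
  in_itv T0 T1 t -> area g u v t = - (r t ^ 2 * Derive a t).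
Proof.
  intros hr ha h ht. unfold area, vel.
  rewrite (Derive_ext_on T0 T1 (fun s => g s u) _ t ht (fun s hs => proj1 (h s hs))).
  rewrite (Derive_ext_on T0 T1 (fun s => g s v) _ t ht (fun s hs => proj2 (h s hs))).
  destruct (h t ht) as [-> ->].
  destruct (hr t ht) as [dr _]. destruct (ha t ht) as [da _].
  rewrite (is_derive_mult_comp r sinh a t _ dr da (is_derive_sinh _)).
  rewrite (is_derive_mult_comp r cosh a t _ dr da (is_derive_cosh _)).
  transitivity (- (r t ^ 2 * Derive a t * (cosh (a t) * cosh (a t) - sinh (a t) * sinh (a t))));
    [ring | rewrite cosh2_sinh2; ring].
Qed.

(** The half-turn in the [wx] plane fixes body 1 and swaps bodies 2 and 3. For [u] in that plane and
    [v] outside it, body 1 contributes zero and the other two contributions are opposite. *)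
Lemma no_rotation_symmetric (m : R) (T0 T1 : Rbar) (q : motion) (u v : coord) :
  (forall t, in_itv T0 T1 t ->
     q Body1 t u = 0 /\ q Body3 t u = - q Body2 t u /\ q Body3 t v = q Body2 t v) ->
  no_rotation (fun _ => m) T0 T1 q u v.
Proof.
  intros h t ht. unfold ang_mom, sum3, vel.
  rewrite (Derive_ext_on T0 T1 (fun s => q Body1 s u) (fun _ => 0) t ht
             (fun s hs => proj1 (h s hs))), Derive_const.
  rewrite (Derive_ext_on T0 T1 (fun s => q Body3 s u) (fun s => - q Body2 s u) t ht
             (fun s hs => proj1 (proj2 (h s hs)))), Derive_opp.
  rewrite (Derive_ext_on T0 T1 (fun s => q Body3 s v) (fun s => q Body2 s v) t ht
             (fun s hs => proj2 (proj2 (h s hs)))).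
  destruct (h t ht) as (-> & -> & ->). ring.
Qed.

(** * Geodesics and mutual products in polar form *)

Definition radial_geodesic (a b s : R) : vec :=
  vec4 (sinh s * cos a) (sinh s * sin a) (cosh s * sinh b) (cosh s * cosh b).

Lemma Derive_sinh_scal (c s : R) : Derive (fun u => sinh u * c) s = cosh s * c.
Proof.
  rewrite (Derive_scal_l sinh c), (is_derive_unique _ _ _ (is_derive_sinh s)).
  reflexivity.
Qed.

Lemma Derive_cosh_scal (c s : R) : Derive (fun u => cosh u * c) s = sinh s * c.
Proof.
  rewrite (Derive_scal_l cosh c), (is_derive_unique _ _ _ (is_derive_cosh s)).
  reflexivity.
Qed.

(** The curve leaves [(0, 0, sinh b, cosh b)] in the unit direction [(cos a, sin a, 0, 0)]. Since
    [sinh] and [cosh] are their own second derivatives, its acceleration equals its position, which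
    is the geodesic equation at unit speed. *)
Lemma radial_geodesicP (a b : R) : geodesic (radial_geodesic a b).
Proof.
  assert (ds : forall c s, ex_derive (fun u => sinh u * c) s).
  { intros c s. exists (cosh s * c).
    apply (is_derive_ext (fun u => scal c (sinh u))); [intros; apply Rmult_comm |].
    rewrite Rmult_comm. exact (is_derive_scal sinh s c _ (is_derive_sinh s)). }
  assert (dc : forall c s, ex_derive (fun u => cosh u * c) s).
  { intros c s. exists (sinh s * c).
    apply (is_derive_ext (fun u => scal c (cosh u))); [intros; apply Rmult_comm |].
    rewrite Rmult_comm. exact (is_derive_scal cosh s c _ (is_derive_cosh s)). }
  assert (hv : forall s k, vel (radial_geodesic a b) s k
    = vec4 (cosh s * cos a) (cosh s * sin a) (sinh s * sinh b) (sinh s * cosh b) k).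
  { intros s k; destruct k; unfold vel; cbn;
      first [apply Derive_sinh_scal | apply Derive_cosh_scal]. }
  assert (ha : forall s k, acc (radial_geodesic a b) s k = radial_geodesic a b s k).
  { intros s k. unfold acc, vel at 1.
    rewrite (Derive_ext _ _ s (fun u => hv u k)).
    destruct k; cbn; first [apply Derive_sinh_scal | apply Derive_cosh_scal]. }
  split.
  - intros k s. split.
    + destruct k; cbn; auto.
    + apply (ex_derive_ext _ _ s (fun u => eq_sym (hv u k))). destruct k; cbn; auto.
  - intros s.
    pose proof (sin2_cos2 a) as ea. unfold Rsqr in ea.
    pose proof (cosh2_sinh2 b) as eb. pose proof (cosh2_sinh2 s) as es.
    assert (speed : lorentz (vel (radial_geodesic a b) s) (vel (radial_geodesic a b) s) = 1).
    { unfold lorentz. rewrite !hv. cbn.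
      transitivity (cosh s * cosh s * (sin a * sin a + cos a * cos a)
        - sinh s * sinh s * (cosh b * cosh b - sinh b * sinh b)); [ring |].
      rewrite ea, eb. lra. }
    split; [split | split].
    + unfold lorentz; cbn.
      transitivity (sinh s * sinh s * (sin a * sin a + cos a * cos a)
        - cosh s * cosh s * (cosh b * cosh b - sinh b * sinh b)); [ring |].
      rewrite ea, eb. lra.
    + cbn. pose proof (cosh_ge_1 s). pose proof (cosh_ge_1 b). nra.
    + exact speed.
    + intros k. rewrite speed, ha. ring.
Qed.

Lemma cosh_arcsinh (x y : R) : 0 < y -> x ^ 2 - y ^ 2 = -1 -> cosh (arcsinh x) = y.
Proof.
  intros hy h. pose proof (cosh2_sinh2 (arcsinh x)) as e.
  rewrite sinh_arcsinh in e. pose proof (cosh_ge_1 (arcsinh x)). nra.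
Qed.

(** The parameter [arcsinh r] is signed, so bodies with opposite [r] lie on the same geodesic, on
    either side of its starting point. *)
Lemma polar_on_geodesic (a b r rho : R) :
  0 < rho -> r ^ 2 - rho ^ 2 = -1 ->
  exists s, forall k, vec4 (r * cos a) (r * sin a) (rho * sinh b) (rho * cosh b) k
    = radial_geodesic a b s k.
Proof.
  intros hp h. exists (arcsinh r). intros k. unfold radial_geodesic.
  now rewrite sinh_arcsinh, (cosh_arcsinh r rho hp h).
Qed.

Lemma lorentz_polar (a b r rho r' rho' : R) :
  lorentz (vec4 (r * cos a) (r * sin a) (rho * sinh b) (rho * cosh b))
          (vec4 (r' * cos a) (r' * sin a) (rho' * sinh b) (rho' * cosh b))
  = r * r' - rho * rho'.
Proof.
  unfold lorentz; cbn. pose proof (sin2_cos2 a) as ea. unfold Rsqr in ea.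
  transitivity (r * r' * (sin a * sin a + cos a * cos a)
    - rho * rho' * (cosh b * cosh b - sinh b * sinh b)); [ring |].
  rewrite ea, cosh2_sinh2. ring.
Qed.

Lemma twice_diff_const (T0 T1 : Rbar) (c : R) : twice_diff_on T0 T1 (fun _ => c).
Proof.
  intros t _. split; [apply ex_derive_const |].
  apply (ex_derive_ext (fun _ => 0)); [| apply ex_derive_const].
  intros s. symmetry. apply Derive_const.
Qed.

Lemma twice_diff_opp (T0 T1 : Rbar) (f : R -> R) :
  twice_diff_on T0 T1 f -> twice_diff_on T0 T1 (fun t => - f t).
Proof.
  intros hf t ht. destruct (hf t ht) as [d dd]. split.
  - exact (ex_derive_opp f t d).
  - apply (ex_derive_ext (fun s => - Derive f s)); [| exact (ex_derive_opp _ t dd)].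
    intros s. symmetry. apply Derive_opp.
Qed.

Theorem proposition13 (m : R) (T0 T1 : Rbar) (q : motion)
    (r rho alpha beta : R -> R)
    (hm : 0 < m)
    (hr : twice_diff_on T0 T1 r) (hrho : twice_diff_on T0 T1 rho)
    (halpha : twice_diff_on T0 T1 alpha) (hbeta : twice_diff_on T0 T1 beta)
    (nalpha : nonconstant_on T0 T1 alpha) (nbeta : nonconstant_on T0 T1 beta)
    (hrrho : forall t, in_itv T0 T1 t -> r t ^ 2 - rho t ^ 2 = -1)
    (hform : forall t, in_itv T0 T1 t -> forall k,
       q Body1 t k = vec4 0 0 (sinh (beta t)) (cosh (beta t)) k /\
       q Body2 t k = vec4 (r t * cos (alpha t)) (r t * sin (alpha t))
                       (rho t * sinh (beta t)) (rho t * cosh (beta t)) k /\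
       q Body3 t k = vec4 (- r t * cos (alpha t)) (- r t * sin (alpha t))
                       (rho t * sinh (beta t)) (rho t * cosh (beta t)) k)
    (hsol : solution (fun _ => m) T0 T1 q) :
  neg_elliptic_hyperbolic_RE (fun _ => m) T0 T1 q /\
  Eulerian T0 T1 q /\
  rotates (fun _ => m) T0 T1 q Cw Cx /\
  rotates (fun _ => m) T0 T1 q Cy Cz /\
  no_rotation (fun _ => m) T0 T1 q Cw Cy /\
  no_rotation (fun _ => m) T0 T1 q Cw Cz /\
  no_rotation (fun _ => m) T0 T1 q Cx Cy /\
  no_rotation (fun _ => m) T0 T1 q Cx Cz.
Proof.
  (* A signed radius for body 3, instead of a phase shift by a half-turn, puts all bodies in one
     polar form with common angles and zero phases. *)
  set (rr := fun (i : body) t => match i with Body1 => 0 | Body2 => r t | Body3 => - r t end).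
  set (ro := fun (i : body) t => match i with Body1 => 1 | _ => rho t end).
  assert (hq : forall i t, in_itv T0 T1 t -> forall k, q i t k =
    vec4 (rr i t * cos (alpha t)) (rr i t * sin (alpha t))
         (ro i t * sinh (beta t)) (ro i t * cosh (beta t)) k).
  { intros i t ht k. destruct (hform t ht k) as (h1 & h2 & h3).
    destruct i; cbn; rewrite ?Rmult_0_l, ?Rmult_1_l; assumption. }
  assert (hrr : forall i, twice_diff_on T0 T1 (rr i)).
  { intros []; [apply twice_diff_const | exact hr | now apply twice_diff_opp]. }
  assert (hro : forall i, twice_diff_on T0 T1 (ro i)).
  { intros []; [apply twice_diff_const | exact hrho | exact hrho]. }
  assert (hrro : forall i t, in_itv T0 T1 t -> rr i t ^ 2 - ro i t ^ 2 = -1).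
  { intros i t ht. pose proof (hrrho t ht). destruct i; cbn in *; lra. }
  (* The sign comes from [z > 0] on the upper sheet, since [z = rho cosh beta] for body 2. *)
  assert (rho_pos : forall t, in_itv T0 T1 t -> 0 < rho t).
  { intros t ht. destruct (proj1 (proj2 hsol t ht) Body2) as [_ hz].
    rewrite (hq _ t ht) in hz. cbn in hz. pose proof (cosh_ge_1 (beta t)). nra. }
  assert (ro_ge1 : forall i t, in_itv T0 T1 t -> 1 <= ro i t).
  { intros i t ht. pose proof (rho_pos t ht). pose proof (hrrho t ht).
    destruct i; cbn; nra. }
  assert (hlor : forall i j t, in_itv T0 T1 t ->
    lorentz (q i t) (q j t) = rr i t * rr j t - ro i t * ro j t).
  { intros i j t ht. rewrite <- (lorentz_polar (alpha t) (beta t)).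
    unfold lorentz. now rewrite !hq. }
  (* The product of bodies 1 and 2 is [- rho], so absence of collisions means [r <> 0]. *)
  assert (r_neq0 : forall t, in_itv T0 T1 t -> r t <> 0).
  { intros t ht h0. destruct (proj2 hsol t ht) as (_ & hnc & _).
    specialize (hnc Body1 Body2 ltac:(discriminate)).
    rewrite (hlor _ _ t ht) in hnc. cbn in hnc.
    pose proof (hrrho t ht) as h. rewrite h0 in *. nra. }
  assert (awx : forall i t, in_itv T0 T1 t -> area (q i) Cw Cx t = rr i t ^ 2 * Derive alpha t).
  { intros i t. apply (area_circular T0 T1); auto. }
  assert (ayz : forall i t, in_itv T0 T1 t -> area (q i) Cy Cz t = - (ro i t ^ 2 * Derive beta t)).
  { intros i t. apply (area_hyperbolic T0 T1); auto. }
  assert (cwx : forall i s t, in_itv T0 T1 s -> in_itv T0 T1 t ->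
    area (q i) Cw Cx s = area (q i) Cw Cx t).
  { intros i. apply (area_constant (fun _ => m)); [exact hsol |].
    intros t ht j. rewrite !hq by assumption. cbn. ring. }
  assert (cyz : forall i s t, in_itv T0 T1 s -> in_itv T0 T1 t ->
    area (q i) Cy Cz s = area (q i) Cy Cz t).
  { intros i. apply (area_constant (fun _ => m)); [exact hsol |].
    intros t ht j. rewrite !hq by assumption. cbn. ring. }
  (* Nonconstancy supplies a point of the interval, used from here on as reference instant. *)
  pose proof nbeta as (t0 & _ & ht0 & _).
  (* If [alpha'] vanished at [t0], the conserved [r^2 alpha'] would be zero throughout, and [r <> 0]
     would make [alpha] constant. *)
  assert (alpha'_neq0 : Derive alpha t0 <> 0).
  { intros h0. apply (nonconstant_derive T0 T1 alpha halpha nalpha). intros t ht.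
    pose proof (cwx Body2 t t0 ht ht0) as e. rewrite !awx, h0 in e by assumption. cbn in e.
    pose proof (r_neq0 t ht). apply (Rmult_eq_reg_l (r t ^ 2)); [lra |].
    now apply pow_nonzero. }
  assert (beta'_const : forall t, in_itv T0 T1 t -> Derive beta t = Derive beta t0).
  { intros t ht. pose proof (cyz Body1 t t0 ht ht0) as e.
    rewrite !ayz in e by assumption. cbn in e. lra. }
  assert (beta'_neq0 : Derive beta t0 <> 0).
  { intros h0. apply (nonconstant_derive T0 T1 beta hbeta nbeta). intros t ht.
    now rewrite beta'_const. }
  assert (rho_const : forall t, in_itv T0 T1 t -> rho t = rho t0).
  { intros t ht. pose proof (cyz Body2 t t0 ht ht0) as e.
    rewrite !ayz, (beta'_const t ht) in e by assumption. cbn in e.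
    pose proof (rho_pos t ht). pose proof (rho_pos t0 ht0).
    assert (rho t * rho t = rho t0 * rho t0).
    { apply (Rmult_eq_reg_r (Derive beta t0)); [lra | assumption]. }
    nra. }
  split; [split; [exact hsol | split] |]; [| | split; [| split; [| split]]].
  - exists rr, ro, alpha, beta, (fun _ => 0), (fun _ => 0).
    do 5 (split; [now auto |]). intros i t ht. rewrite !Rplus_0_r.
    split; [now apply hq |]. split; [| now apply hrro].
    rewrite (hq i t ht). cbn.
    pose proof (ro_ge1 i t ht). pose proof (cosh_ge_1 (beta t)). nra.
  - intros i j _. exists (rr i t0 * rr j t0 - ro i t0 * ro j t0). intros t ht.
    rewrite (hlor i j t ht). pose proof (rho_const t ht) as e.
    (* The products contain [r] only through [r^2 = rho^2 - 1], so constancy of [rho] suffices and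
       the sign of [r] does not matter. *)
    pose proof (hrrho t ht) as h. pose proof (hrrho t0 ht0) as h'.
    destruct i, j; cbn; rewrite e in *; lra.
  (* The geodesic at time [t] starts at body 1 and points along the current angle [alpha t]. *)
  - intros t ht. exists (radial_geodesic (alpha t) (beta t)).
    split; [apply radial_geodesicP |]. intros i.
    destruct (polar_on_geodesic (alpha t) (beta t) (rr i t) (ro i t)) as [s hs].
    + pose proof (ro_ge1 i t ht). lra.
    + now apply hrro.
    + exists s. intros k. rewrite <- hs. now apply hq.
  - exists (m * area (q Body1) Cw Cx t0 + m * area (q Body2) Cw Cx t0
            + m * area (q Body3) Cw Cx t0). split.
    + rewrite !awx by assumption. cbn. intros h.
      (* The total for [wx] is [2 m r^2 alpha'] at [t0], a product of nonzero factors. *)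
      pose proof (Rmult_integral_contrapositive_currified _ _
        (Rmult_integral_contrapositive_currified _ _ (Rgt_not_eq _ _ hm)
           (pow_nonzero _ 2 (r_neq0 t0 ht0))) alpha'_neq0) as hn.
      apply hn. lra.
    + intros t ht. now rewrite !(cwx _ t0 t ht0 ht).
  - exists (m * area (q Body1) Cy Cz t0 + m * area (q Body2) Cy Cz t0
            + m * area (q Body3) Cy Cz t0). split.
    + rewrite !ayz by assumption. cbn. intros h.
      (* The total for [yz] is [- m (1 + 2 rho^2) beta']: body 1 contributes the 1, bodies 2 and 3
         contribute [rho^2] each. *)
      assert (hp : m * (1 + 2 * rho t0 ^ 2) <> 0).
      { pose proof (pow2_ge_0 (rho t0)). nra. }
      apply (Rmult_integral_contrapositive_currified _ _ hp beta'_neq0). lra.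
    + intros t ht. now rewrite !(cyz _ t0 t ht0 ht).
  - repeat split; apply no_rotation_symmetric; intros t ht; rewrite !hq by assumption;
      cbn; repeat split; ring.
Qed.
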